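(* There is an absolute constant $K>0$ such that for every perfect square $n$ and every stacking order $f$ of $\mathcal{D}(G_n)$, $$\lim_{\varepsilon\to 0}\mathrm{vis}(\mathcal{D}(\varepsilon G_n),f)\le K n^{2/3},$$ where $f$ also denotes the corresponding stacking order of $\mathcal{D}(\varepsilon G_n)$.
   Context: For a perfect square $n$, $G_n$ denotes the $n^{1/2}\times n^{1/2}$ uniform grid $\{(a,b)\in\mathbb{Z}^2: 1\le a,b\le n^{1/2}\}$. For a point $p$ in the plane, $D(p)$ denotes the closed disk of radius $1$ centered at $p$, and for a finite point set $P$, $\mathcal{D}(P)=\{D(p): p\in P\}$. A stacking order of a finite collection $\mathcal{D}$ of $n$ distinct unit disks is a bijection $f:\mathcal{D}\to\{1,\dots,n\}$; $f(D)$ is regarded as the height of $D$, and the arrangement is viewed from below. A point $x$ on the boundary circle of $D\in\mathcal{D}$ is visible if $x$ does not lie in any disk $D'\in\mathcal{D}$ with $f(D')<f(D)$. The visible perimeter $\mathrm{vis}(\mathcal{D},f)$ is the total length of all visible boundary points, summed over all disks of $\mathcal{D}$. For $\varepsilon>0$, $\varepsilon P=\{(\varepsilon x,\varepsilon y): (x,y)\in P\}$, and a stacking order $f$ of $\mathcal{D}(P)$ is identified with the stacking order $D(\varepsilon p)\mapsto f(D(p))$ of $\mathcal{D}(\varepsilon P)$. *)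

(* Defs.v *)
From HB Require Import structures.
From mathcomp Require Import all_boot all_order all_algebra.
From mathcomp Require Import all_classical all_reals all_analysis.
Set Implicit Arguments. Unset Strict Implicit. Unset Printing Implicit Defensive.
Import Order.TTheory GRing.Theory Num.Theory.
Import numFieldNormedType.Exports.
Local Open Scope classical_set_scope.
Local Open Scope ring_scope.

(* The grid G_n with n = m^2, indexed by 'I_m * 'I_m; the index (a,b)
   corresponds to the grid point (a+1, b+1), so coordinates range in 1..m. *)
Definition grid_idx (m : nat) := ('I_m * 'I_m)%type.

Definition gx {m : nat} (i : grid_idx m) (R : realType) : R := (i.1.+1)%:R.
Definition gy {m : nat} (i : grid_idx m) (R : realType) : R := (i.2.+1)%:R.

Definition in_disk (R : realType) (m : nat) (eps : R) (j : grid_idx m)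
  (x y : R) : Prop :=
  (x - eps * gx j R) ^+ 2 + (y - eps * gy j R) ^+ 2 <= 1.

(* The set of angles t in [0, 2 pi) such that the boundary point
   eps*p_i + (cos t, sin t) of D(eps p_i) is visible w.r.t. the stacking
   order f (viewed from below: it lies in no disk of smaller height). *)
Definition visible_angles (R : realType) (m : nat) (f : grid_idx m -> 'I_(m * m))
  (eps : R) (i : grid_idx m) : set R :=
  [set t | 0 <= t < 2 * pi /\
     forall j : grid_idx m, (f j < f i)%N ->
       ~ in_disk eps j (eps * gx i R + cos t) (eps * gy i R + sin t)].

(* Visible perimeter of D(eps G_n) under f: since radius is 1, the length of
   the visible part of the boundary circle of D(eps p_i) equals the Lebesgue
   measure of the set of visible angles. *)
Definition vis (R : realType) (m : nat) (f : grid_idx m -> 'I_(m * m))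
  (eps : R) : R :=
  \sum_(i : grid_idx m) fine (lebesgue_measure (visible_angles f eps i)).

(* Main.v *)
(* As eps tends to 0, the visible arc of the i-th circle shrinks to the cone of
   directions u in which p_i is maximal among the points below it. In a direction
   (b - a, a) with 0 <= a <= b, the integer p . (b - a, a) takes at most b m values, so
   at most b m points can be strict records there. Cut a quadrant into N = s^2 arcs,
   s ~ m^(1/3), and pick in (a neighbourhood of) each arc the rational direction a / b
   with the least denominator b. A cone whose interior contains c of the chosen
   directions has angle O((c + 1) / N), so the sum of all cones is
   O((m S + m^2) / N), where S is the sum of the least denominators. Dirichlet's
   approximation theorem gives S = O(s^3): if the least denominator b near k / N exceeds
   s, then k / N lies about j / N away from a fraction a' / b' with b j b' <= 2 N and
   j b' < s, and the sum of 2 N / (j b') over all such (a', b', j) is O(s^3). Altogether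
   the bound is O(m s + m^2 / s^2) = O(m^(4/3)). *)
Require Import Defs.
From HB Require Import structures.
From mathcomp Require Import all_boot all_order all_algebra.
From mathcomp Require Import all_classical all_reals all_analysis.
From mathcomp Require Import measurable_realfun.
From mathcomp Require Import zify ring lra.
Set Implicit Arguments. Unset Strict Implicit. Unset Printing Implicit Defensive.
Import Order.TTheory GRing.Theory Num.Theory.
Import numFieldNormedType.Exports.

(** * Least denominators *)

(** Residues modulo [N] in the same one of [q] boxes of width [N / q] differ by less than [N / q],
    and [B2 - B1] minus the multiple of [N] is the difference of the residues. Subtraction is
    truncated, so two inequalities stand for one absolute value. *)
Lemma same_box_dist (N q B1 B2 : nat) : (0 < N)%N -> (B1 <= B2)%N ->
  (B1 %% N * q %/ N = B2 %% N * q %/ N)%N ->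
  (q * (B2 - B1 - (B2 %/ N - B1 %/ N) * N) < N)%N /\
  (q * ((B2 %/ N - B1 %/ N) * N - (B2 - B1)) < N)%N.
Proof.
move=> N0 le12.
have := leq_div2r N le12.
have := divn_eq B1 N; have := divn_eq B2 N.
move: (B1 %% N)%N (B2 %% N)%N (B1 %/ N)%N (B2 %/ N)%N => r1 r2 d1 d2.
have := divn_eq (r1 * q) N; have := divn_eq (r2 * q) N.
have := ltn_pmod (r1 * q) N0; have := ltn_pmod (r2 * q) N0.
move: (r1 * q %% N)%N (r2 * q %% N)%N (r1 * q %/ N)%N (r2 * q %/ N)%N.
move=> u1 u2 w1 w2 M2 M1 L2 L1 E2 E1 led w12; subst w1.
have ledN : (d1 * N <= d2 * N)%N by rewrite leq_mul2r led orbT.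
rewrite mulnBl.
have -> : (B2 - B1 - (d2 * N - d1 * N) = r2 - r1)%N by clear -E1 E2 ledN le12; lia.
have -> : (d2 * N - d1 * N - (B2 - B1) = r1 - r2)%N by clear -E1 E2 ledN le12; lia.
by rewrite !mulnBr !(mulnC q) L1 L2; clear -M1 M2; lia.
Qed.

(** Pigeonhole: the residues of [b * k] modulo [N] for [b = 0, ..., q] fall into [q] boxes, and the
    difference of two indices sharing a box is the required denominator. *)
Lemma dirichlet_nat (k N q : nat) : (0 < N)%N -> (0 < q)%N ->
  exists a b : nat, [/\ (0 < b <= q)%N, (q * (b * k - a * N) < N)%N
                      & (q * (a * N - b * k) < N)%N].
Proof.
move=> N0; case: q => // q _.
pose h (b : 'I_q.+2) : 'I_q.+1 := inord ((b * k %% N) * q.+1 %/ N).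
have hE b : h b = ((b * k %% N) * q.+1 %/ N)%N :> nat.
  rewrite inordK // ltn_divLR // [X in (_ < X)%N]mulnC ltn_pmul2r //.
  by rewrite ltn_mod.
have /injectivePn[b1 [b2 b12 eqh]] : ~~ injectiveb h.
  apply/negP => /injectiveP /leq_card; rewrite !card_ord; lia.
wlog lt12 : b1 b2 b12 eqh / (b1 < b2)%N.
  move=> H; case: (ltngtP b1 b2) => [lt|lt|e].
  - exact: (H b1 b2).
  - by apply: (H b2 b1) => //; rewrite eq_sym.
  - by case/eqP: b12; apply: val_inj.
have := congr1 val eqh; rewrite /= !hE => e12.
exists (b2 * k %/ N - b1 * k %/ N)%N, (b2 - b1)%N.
have le2 := ltn_ord b2.
have lek : (b1 * k <= b2 * k)%N by rewrite leq_mul2r (ltnW lt12) orbT.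
have [h1 h2] := same_box_dist N0 lek e12.
split; [by clear -le2 lt12; lia
  | by rewrite [in X in (_ * (X - _) < _)%N]mulnBl
  | by rewrite [in X in (_ * (_ - X) < _)%N]mulnBl].
Qed.

(* |a / b - k / N| <= 1 / N, with denominators cleared. *)
Definition approx (N k b a : nat) :=
  (b * k <= a * N + b)%N && (a * N <= b * k + b)%N.

Lemma min_den_exists (N k : nat) : (k < N)%N -> exists a b : nat,
  [/\ (0 < b)%N, (a <= b)%N, approx N k b a
    & forall a' b', (0 < b' < b)%N -> ~~ approx N k b' a'].
Proof.
move=> kN.
have ex : exists b, (0 < b)%N && [exists a : 'I_b.+1, approx N k b a].
  exists N; rewrite (leq_ltn_trans _ kN) //=; apply/existsP.
  have kN' : (k < N.+1)%N by lia.
  by exists (Ordinal kN'); rewrite /approx /= mulnC leq_addr /=.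
case: (ex_minnP ex) => b /andP[b0 /existsP[a ab]] bmin.
exists a, b; split => //; first by have := ltn_ord a.
move=> a' b' /andP[b'0 b'b]; apply/negP => ab'.
suff /bmin : (0 < b')%N && [exists a : 'I_b'.+1, approx N k b' a] by lia.
rewrite b'0; apply/existsP.
(* The minimum was taken over fractions with numerator at most the denominator. As [k < N], every
   approximating numerator satisfies this, so minimality extends to all of them. *)
have a'b' : (a' < b'.+1)%N.
  case/andP: ab' => _ h; rewrite ltnS.
  have: (a' * N <= b' * N)%N.
    by apply: (leq_trans h); rewrite -mulnSr leq_mul2l kN orbT.
  by rewrite leq_mul2r; case: eqP => //= N0; lia.
by exists (Ordinal a'b').
Qed.

(* For the b', a' of Dirichlet's theorem put e = |b' k - a' s^2|; minimality of b gives
   e > b', and j is e %/ b', so k is recovered from (a', b', j) up to a sign. *)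
Lemma min_den_witness (s k b : nat) : (k < s ^ 2)%N -> (s < b)%N ->
  (forall a' b', (0 < b' < b)%N -> ~~ approx (s ^ 2) k b' a') ->
  exists b' a' j : nat, [/\ (0 < b' < s)%N, (a' <= b')%N, (0 < j)%N /\ (j * b' < s)%N,
   (b * (j * b') <= 2 * s ^ 2)%N
   & k = (j + (a' * s ^ 2 + b'.-1) %/ b')%N \/ k = (a' * s ^ 2 %/ b' - j)%N].
Proof.
move=> kN sb bmin.
have s0 : (0 < s)%N by case: s kN {bmin sb}.
have N0 : (0 < s ^ 2)%N by rewrite expn_gt0 s0.
have [//||a' [b' [/andP[b'0 b'b] e1 e2]]] := @dirichlet_nat k (s ^ 2) b.-1; first by lia.
have /bmin : (0 < b' < b)%N by lia.
move=> /(_ a'); rewrite /approx negb_and -!ltnNge => hna.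
move: kN N0 e1 e2 hna; rewrite -mulnn; set N := (s * s)%N => kN N0 e1 e2 hna.
have sN : (s <= N)%N by rewrite /N leq_pmull.
pose e := ((b' * k - a' * N) + (a' * N - b' * k))%N.
have qe : (b.-1 * e < N)%N by rewrite /e; case: (leqP (b' * k) (a' * N)) => h;
  [have -> : (b' * k - a' * N = 0)%N by lia|have -> : (a' * N - b' * k = 0)%N by lia];
  rewrite ?addn0 ?add0n.
have b'e : (b' < e)%N by rewrite /e; case/orP: hna; lia.
have es : (e < s)%N.
  rewrite ltnNge; apply/negP => se.
  have : (s * s <= b.-1 * e)%N by apply: leq_mul; lia.
  by rewrite -/N; lia.
exists b', a', (e %/ b')%N.
have je := leq_trunc_div e b'.
have aN : (a' * N < b'.+1 * N)%N.
  have : (a' * N <= b' * k + e)%N by rewrite /e; lia.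
  have : (b' * k <= b' * N)%N by rewrite leq_mul2l (ltnW kN) orbT.
  rewrite mulSn; lia.
split.
- by apply/andP; split; lia.
- by move: aN; rewrite ltn_mul2r N0 /= ltnS.
- by rewrite divn_gt0 //; split; lia.
- apply: (@leq_trans (b * e)); first by rewrite leq_mul2l je orbT.
  have : (b * e <= 2 * (b.-1 * e))%N by rewrite mulnA leq_mul2r; apply/orP; right; lia.
  lia.
- have De := divn_eq e b'.
  have Me : (e %% b' < b')%N by rewrite ltn_mod.
  (* If [k] lies above [a' * N / b'], then [k - e %/ b'] is the ceiling of that quotient, whence the
     added [b'.-1]; if it lies below, [k + e %/ b'] is the floor. *)
  case/orP: hna => h.
    left; have Ee : (b' * k = a' * N + e)%N by rewrite /e; lia.
    have -> : (a' * N + b'.-1 = (k - e %/ b') * b' + (b'.-1 - e %% b'))%N.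
      rewrite mulnBl; lia.
    rewrite divnMDl // (@divn_small (_ - _)) ?addn0; last by clear -b'0; lia.
    have : (e %/ b' * b' <= k * b')%N by lia.
    rewrite leq_mul2r; lia.
  right; have Ee : (a' * N = b' * k + e)%N by rewrite /e; lia.
  have -> : (a' * N = (k + e %/ b') * b' + e %% b')%N by rewrite mulnDl; lia.
  by rewrite divnMDl // (@divn_small (_ %% _)) // addn0 addnK.
Qed.

Local Open Scope ring_scope.

(** * Summing the least denominators *)

Lemma sum_inv_sq (R : realFieldType) (s : nat) :
  \sum_(1 <= j < s.+1) (j%:R ^- 2 : R) <= 2.
Proof.
case: s => [|s]; first by rewrite big_geq.
(* The sharper bound makes the induction work, since [1 / (x + 1)^2 <= 1 / x - 1 / (x + 1)]. *)
suff h : \sum_(1 <= j < s.+2) (j%:R ^- 2 : R) <= 2 - (s.+1)%:R^-1.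
  by apply: (le_trans h); rewrite lerBlDr lerDl invr_ge0 ler0n.
elim: s => [|s IH]; first by rewrite big_nat1 invr1 expr1n invr1; lra.
rewrite big_nat_recr //=; apply: le_trans (lerD IH (lexx _)) _.
have -> : (s.+2)%:R = (s.+1)%:R + 1 :> R by rewrite -natr1.
have : 0 < (s.+1)%:R :> R by rewrite ltr0n.
move: (s.+1)%:R => x x0.
rewrite -subr_ge0.
have -> : 2 - (x + 1)^-1 - (2 - x^-1 + (x + 1) ^- 2) = (x^-1) * (x + 1) ^- 2 :> R.
  by field; lra.
by rewrite mulr_ge0 // invr_ge0 ?exprn_ge0 //; lra.
Qed.

(** Each [j] admits at most [s / j] values of [b], so the sum is at most [s] times the sum of
    [1 / j^2]. *)
Lemma sum_inv_hyperbola (R : realFieldType) (s : nat) :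
  \sum_(b < s) \sum_(j < s | [&& 0 < b, 0 < j & j * b < s]%N) (j%:R^-1 : R)
  <= 2 * s%:R.
Proof.
rewrite (exchange_big_dep (fun j : 'I_s => (0 < j)%N)) /=; last first.
  by move=> b j _ /and3P[].
apply: (@le_trans _ _ (\sum_(j < s | (0 < j)%N) s%:R * (j%:R ^- 2 : R))).
  apply: ler_sum => j j0.
  rewrite sumr_const -[X in X <= _]mulr_natl exprS expr1 invfM mulrA.
  rewrite ler_wpM2r ?invr_ge0 ?ler0n // ler_pdivlMr ?ltr0n // -natrM ler_nat.
  rewrite -leq_divRL //.
  set A := (X in #|X|).
  have sub : forall b : 'I_s, b \in A -> (b.-1 < s %/ j)%N.
    move=> b; rewrite unfold_in => /and3P[b0 _ jb]; rewrite prednK // leq_divRL //.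
    by rewrite mulnC ltnW.
  case: (posnP (s %/ j)) => [z|z].
    rewrite leqNgt z; apply/negP => /card_gt0P[b /sub].
    by rewrite z.
  rewrite -[leqRHS](prednK z) -[leqRHS]card_ord.
  rewrite -(@card_in_imset _ _ (fun b : 'I_s => inord b.-1 : 'I_(s %/ j).-1.+1)).
    exact: max_card.
  move=> b b' bA b'A /(congr1 val) /=.
  rewrite !inordK ?(prednK z); try exact: sub.
  move=> e; apply: val_inj => /=.
  by move: bA b'A; rewrite !unfold_in => /and3P[? _ _] /and3P[? _ _]; lia.
rewrite -mulr_sumr mulrC ler_wpM2r ?ler0n //.
apply: le_trans (sum_inv_sq R s).
case: s => [|s]; first by rewrite big_ord0 big_geq.
rewrite -(big_mkord (fun j => 0 < j)%N (fun j => j%:R ^- 2 : R)).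
rewrite big_mkcond big_nat_recl //= add0r big_add1 /= [leRHS]big_nat_recr //=.
by rewrite lerDl invr_ge0 exprn_ge0 // ler0n.
Qed.

(** Denominators up to [s] contribute at most [s * s^2]. A larger one is at most [w b j] for a
    triple [(b, a, j)] given by [min_den_witness]. Each triple serves at most two [k], and summing
    over [a] cancels the [1 / b] in [w], leaving [8 * s^2 / j]; the hyperbola sum turns this into
    [16 * s^3]. *)
Lemma sum_min_den (R : realFieldType) (s : nat) (den : nat -> nat) :
  (forall k, (k < s ^ 2)%N -> forall a b,
     (0 < b < den k)%N -> ~~ approx (s ^ 2) k b a) ->
  \sum_(k < s ^ 2) ((den k)%:R : R) <= 17 * s%:R ^+ 3.
Proof.
move=> denP.
pose N := (s ^ 2)%N.
pose P (b a j : nat) := [&& 0 < b, a <= b, 0 < j & j * b < s]%N.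
pose w (b j : nat) : R := 2 * s%:R ^+ 2 / (j%:R * b%:R).
(* The two terms are the two ways of recovering [k] from the triple. *)
pose hit (k b a j : nat) : R := ((k == j + (a * N + b.-1) %/ b)%N%:R + (k == a * N %/ b - j)%N%:R).
have w0 b j : 0 <= w b j.
  by rewrite /w divr_ge0 ?mulr_ge0 ?exprn_ge0 ?ler0n.
have hit0 k b a j : 0 <= hit k b a j by rewrite addr_ge0 ?ler0n.
have key (k : 'I_N) : (den k)%:R <= s%:R +
    \sum_(b < s) \sum_(a < s) \sum_(j < s | P b a j) hit k b a j * w b j.
  have S0 : 0 <= \sum_(b < s) \sum_(a < s) \sum_(j < s | P b a j) hit k b a j * w b j.
    by do 3 (apply: sumr_ge0 => ? _); rewrite mulr_ge0.
  case: (leqP (den k) s) => [ds|sd].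
    by apply: ler_wpDr => //; rewrite ler_nat.
  have [b [a [j [/andP[b0 bs] ab [j0 jb] le ke]]]] :=
    min_den_witness (ltn_ord k) sd (denP _ (ltn_ord k)).
  apply: ler_wpDl; first by rewrite ler0n.
  have aS : (a < s)%N by apply: leq_ltn_trans bs.
  have jS : (j < s)%N by apply: leq_ltn_trans jb; rewrite leq_pmulr.
  rewrite (bigD1 (Ordinal bs)) //= (bigD1 (Ordinal aS)) //=.
  rewrite (bigD1 (Ordinal jS)) /=; last by rewrite /P b0 ab j0 jb.
  rewrite -!addrA; apply: ler_wpDr.
    by rewrite !addr_ge0 //; do ?(apply: sumr_ge0 => ? _); rewrite mulr_ge0.
  have : 1 <= hit k b a j.
    rewrite /hit -/N; case: ke => <-; rewrite eqxx ?lerDl ?lerDr ?ler0n //.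
  have : (den k)%:R <= w b j.
    rewrite /w ler_pdivlMr ?mulr_gt0 ?ltr0n // -natrX -!natrM ler_nat //.
  move=> h1 h2; apply: (le_trans h1); exact: ler_peMl.
apply: (le_trans (ler_sum _ (fun k _ => key k))).
rewrite big_split /= sumr_const card_ord.
have -> : s%:R *+ N = s%:R ^+ 3 :> R by rewrite -mulr_natr natrX -exprS.
rewrite exchange_big /=.
have step : \sum_(b < s) \sum_(k < N) \sum_(a < s) \sum_(j < s | P b a j) hit k b a j * w b j
   <= \sum_(b < s) \sum_(j < s | [&& 0 < b, 0 < j & j * b < s]%N) 8 * s%:R ^+ 2 * (j%:R^-1 : R).
  apply: ler_sum => b _; rewrite exchange_big /=.
  have h1 : \sum_(a < s) \sum_(k < N) \sum_(j < s | P b a j) hit k b a j * w b j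
     <= \sum_(a < s) \sum_(j < s | P b a j) 2 * w b j.
    apply: ler_sum => a _; rewrite exchange_big /=; apply: ler_sum => j _.
    rewrite -mulr_suml ler_wpM2r // big_split /=.
    have one c : \sum_(i < N) ((i == c :> nat)%:R : R) <= 1.
      case: (ltnP c N) => cN.
        rewrite (bigD1 (Ordinal cN)) //= eqxx big1 ?addr0 // => i /negP ni.
        by case: eqP => // e; case: ni; apply/eqP/val_inj.
      by rewrite big1 ?ler01 // => i _; have := ltn_ord i; case: eqP => // ->; rewrite ltnNge cN.
    by apply: (le_trans (lerD (one _) (one _))).
  apply: (le_trans h1).
  rewrite (exchange_big_dep (fun j : 'I_s => [&& 0 < b, 0 < j & j * b < s]%N)) /=; last first.
    by move=> a j _ /and4P[-> _ -> ->].
  apply: ler_sum => j /and3P[b0 j0 jb].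
  (* Since [b < s], every numerator [0, ..., b] occurs in ['I_s]. *)
  have -> : \sum_(a < s | P b a j) 2 * w b j = (b.+1)%:R * (2 * w b j).
    rewrite sumr_const -[LHS]mulr_natl; congr (_%:R * _).
    rewrite -[RHS]card_ord.
    have bs : (b.+1 <= s)%N := ltn_ord b.
    have winj : injective (widen_ord bs) by move=> x y /(congr1 val) /= ?; apply: val_inj.
    rewrite -(card_codom winj); apply: eq_card => a.
    rewrite unfold_in /P b0 j0 jb !andbT /=; apply/idP/codomP => [ab|[x ->]] /=.
      by exists (Ordinal (ab : (a < b.+1)%N)); apply: val_inj.
    by rewrite -ltnS.
  rewrite /w.
  (* The constant 8 comes from [b + 1 <= 2 * b], the two hits and the factor 2 in [w]. *)
  have -> : 8 * s%:R ^+ 2 / j%:R = (2 * b%:R) * (2 * (2 * s%:R ^+ 2 / (j%:R * b%:R))) :> R.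
    by field; rewrite !pnatr_eq0 -!lt0n j0 b0.
  apply: ler_wpM2r; first by rewrite mulr_ge0 // w0.
  rewrite -natrM ler_nat; clear -b0; lia.
apply: le_trans (lerD (lexx _) step) _.
under eq_bigr do rewrite -mulr_sumr.
rewrite -mulr_sumr.
have h := sum_inv_hyperbola R s.
have : 8 * s%:R ^+ 2 * (\sum_(b < s) \sum_(j < s | [&& 0 < b, 0 < j & j * b < s]%N)
    (j%:R^-1 : R)) <= 8 * s%:R ^+ 2 * (2 * s%:R).
  by rewrite ler_wpM2l // mulr_ge0 // exprn_ge0 ?ler0n.
move=> h2; apply: le_trans (lerD (lexx _) h2) _.
by rewrite le_eqVlt; apply/orP; left; apply/eqP; ring.
Qed.

(** * Strict records *)

Definition strict_records (T : finType) (h v : T -> nat) : {set T} :=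
  [set i | [forall j, (h j < h i) ==> (v j < v i)]]%N.

(** [v] is injective on the strict records: of two records, the one with larger [h] has the larger
    value. *)
Lemma card_strict_records (T : finType) (h v : T -> nat) (B : nat) :
  injective h -> (forall i, (v i < B)%N) -> (#|strict_records h v| <= B)%N.
Proof.
move=> hinj vB.
rewrite -[leqRHS]card_ord.
rewrite -(@card_in_imset _ _ (fun i => Ordinal (vB i))); first exact: max_card.
move=> i j; rewrite !inE => /forallP/(_ j)/implyP hi /forallP/(_ i)/implyP hj.
move=> /(congr1 val) /= e; apply: hinj.
by case: (ltngtP (h i) (h j)) => // [/hj|/hi]; rewrite e ltnn.
Qed.

(** Turns the weak inequalities at two directions of a cone into strict ones in between. The value
    at [y] is a positive combination of the two end values; if it vanished, both would, forcing
    [p = q = 0]. *)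
Lemma affine_gt0_between (R : realFieldType) (p q x1 x2 y : R) :
  x1 < y < x2 -> (p != 0) || (q != 0) ->
  0 <= (1 - x1) * p + x1 * q -> 0 <= (1 - x2) * p + x2 * q ->
  0 < (1 - y) * p + y * q.
Proof.
move=> /andP[lt1 lt2] pq h1 h2.
have E : (x2 - x1) * ((1 - y) * p + y * q) =
  (x2 - y) * ((1 - x1) * p + x1 * q) + (y - x1) * ((1 - x2) * p + x2 * q) by ring.
have d1 : 0 < x2 - y by rewrite subr_gt0.
have d2 : 0 < y - x1 by rewrite subr_gt0.
have d3 : 0 < x2 - x1 by lra.
rewrite -(pmulr_rgt0 _ d3) E lt_neqAle addr_ge0 ?andbT; try by rewrite mulr_ge0 // ltW.
rewrite eq_sym paddr_eq0; try by rewrite mulr_ge0 // ltW.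
rewrite !mulf_eq0 (gt_eqF d1) (gt_eqF d2) /=; apply/negP => /andP[/eqP z1 /eqP z2].
have qp : (x2 - x1) * (q - p) = 0.
  have -> : (x2 - x1) * (q - p) = ((1 - x2) * p + x2 * q) - ((1 - x1) * p + x1 * q) by ring.
  by rewrite z1 z2 subrr.
have /eqP := qp; rewrite mulf_eq0 (gt_eqF d3) /= subr_eq0 => /eqP qpe.
by move: z1 pq; rewrite qpe -mulrDl subrK mul1r => ->; rewrite eqxx.
Qed.

(** [c i] counts the chosen directions in which [i] is a strict record. Double counting bounds its
    sum by [m] times the sum of the denominators. An interval longer than [(c i + 3) / N] would
    contain [c i + 1] chosen directions in its interior, each making [i] a strict record. *)
Lemma record_intervals (R : archiRealFieldType) (T : finType) (m s : nat) (h X Y : T -> nat) :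
  injective h -> (forall i j, X i = X j -> Y i = Y j -> i = j) ->
  (forall i, (X i < m)%N) -> (forall i, (Y i < m)%N) -> (0 < s)%N ->
  exists c : T -> nat,
    \sum_i ((c i)%:R : R) <= 17 * s%:R ^+ 3 * m%:R /\
    forall (i : T) (x1 x2 : R), 0 <= x1 -> x2 <= 1 ->
     (forall j, (h j < h i)%N ->
        0 <= (1 - x1) * ((X i)%:R - (X j)%:R) + x1 * ((Y i)%:R - (Y j)%:R)) ->
     (forall j, (h j < h i)%N ->
        0 <= (1 - x2) * ((X i)%:R - (X j)%:R) + x2 * ((Y i)%:R - (Y j)%:R)) ->
     x2 - x1 <= ((c i)%:R + 3) / s%:R ^+ 2.
Proof.
move=> hinj XYinj Xm Ym s0; pose N := (s ^ 2)%N.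
have N0 : (0 < N)%N by rewrite expn_gt0 s0.
have NR0 : 0 < (N%:R : R) by rewrite ltr0n.
have /fin_all_exists[num /fin_all_exists[den abP]] :
  forall k : 'I_N, exists a b : nat,
  [/\ (0 < b)%N, (a <= b)%N, approx N k b a
    & forall a' b', (0 < b' < b)%N -> ~~ approx N k b' a'].
  by move=> k; exact: min_den_exists (ltn_ord k).
(* With [y = num k / den k] this is [den k] times [(1 - y) * X i + y * Y i], an integer below
   [den k * m]. *)
pose v (k : 'I_N) (i : T) := ((den k - num k) * X i + num k * Y i)%N.
pose c i := #|[set k : 'I_N | i \in strict_records h (v k)]|.
exists c; split.
  have -> : \sum_i ((c i)%:R : R) = \sum_(k : 'I_N) (#|strict_records h (v k)|)%:R.
    rewrite -!natr_sum; congr _%:R.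
    transitivity (\sum_i \sum_(k : 'I_N) (i \in strict_records h (v k) : nat))%N.
      apply: eq_bigr => i _; rewrite /c -sum1_card big_mkcond.
      by apply: eq_bigr => k _; rewrite inE; case: (_ \in _).
    rewrite exchange_big /=; apply: eq_bigr => k _.
    by rewrite -sum1_card [RHS]big_mkcond; apply: eq_bigr => i _; case: (_ \in _).
  apply: (@le_trans _ _ (\sum_(k < N) (den k)%:R * m%:R)).
    apply: ler_sum => k _; rewrite -natrM ler_nat.
    have [b0 ab _ _] := abP k.
    apply: card_strict_records => // i; rewrite /v.
    have m0 : (0 < m)%N by apply: leq_ltn_trans (Xm i).
    apply: (@leq_ltn_trans ((den k - num k) * m.-1 + num k * m.-1)).
      by apply: leq_add; rewrite leq_mul2l; apply/orP; right; rewrite -ltnS prednK.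
    by rewrite -mulnDl subnK // ltn_mul2l b0 ltn_predL.
  rewrite -mulr_suml ler_wpM2r ?ler0n //.
  (* [den] lives on ['I_N] while [sum_min_den] takes a function on [nat]; the default 0 is only
     taken for [k >= N], outside the sum. *)
  pose dn k := oapp den 0%N (insub k).
  rewrite (_ : \sum_(k < N) _ = \sum_(k < N) (dn k)%:R); last first.
    by apply: eq_bigr => k _; rewrite /dn valK.
  apply: sum_min_den => k kN a b; rewrite /dn insubT /=.
  by have [_ _ _ +] := abP (Sub k kN); apply.
move=> i x1 x2 x10 x21 H1 H2.
have -> : s%:R ^+ 2 = N%:R :> R by rewrite natrX.
rewrite ler_pdivlMr // leNgt; apply/negP => lt.
(* The fraction chosen for [k] lies within [1 / N] of [k / N], so it is inside [(x1, x2)] once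
   [k - 1 > N * x1] and [k + 1 < N * x2]. The first holds from [l] on, and
   [l + c i + 1 <= N * x1 + c i + 3] gives the second for [l, ..., l + c i]: this is the 3 in the
   bound. *)
pose l := (Num.truncn (N%:R * x1)).+2.
have /andP[l1 l2] := truncn_itv (mulr_ge0 (ltW NR0) x10).
have good (k : 'I_N) : (l <= k)%N -> (k.+1%:R < N%:R * x2) ->
    k \in [set k : 'I_N | i \in strict_records h (v k)].
  move=> lk kx2.
  have [b0 ab /andP[ap1 ap2] _] := abP k.
  rewrite inE /strict_records inE; apply/forallP => j; apply/implyP => hji.
  have bR0 : 0 < ((den k)%:R : R) by rewrite ltr0n.
  set y : R := (num k)%:R / (den k)%:R.
  have lky : N%:R * x1 < N%:R * y.
    apply: (lt_le_trans l2).
    have : (den k)%:R * k%:R <= (num k)%:R * N%:R + (den k)%:R :> R.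
      by rewrite -!natrM -natrD ler_nat.
    rewrite /y mulrA ler_pdivlMr // => hh.
    have : l%:R <= k%:R :> R by rewrite ler_nat.
    rewrite /l -natr1 => lk'.
    have : (den k)%:R * (l.-1)%:R <= (den k)%:R * (k%:R - 1) :> R.
      rewrite ler_wpM2l // ?ler0n // /l /=; lra.
    rewrite /l /=; lra.
  have kuy : N%:R * y < N%:R * x2.
    apply: le_lt_trans kx2.
    have : (num k)%:R * N%:R <= (den k)%:R * k%:R + (den k)%:R :> R.
      by rewrite -!natrM -natrD ler_nat.
    rewrite /y mulrA ler_pdivrMr // -natr1; lra.
  have := affine_gt0_between _ _ (H1 _ hji) (H2 _ hji).
  move=> /(_ y); rewrite -(ltr_pM2l NR0 x1) -(ltr_pM2l NR0 y) lky kuy => /(_ isT).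
  have -> : ((X i)%:R - (X j)%:R != 0 :> R) || ((Y i)%:R - (Y j)%:R != 0 :> R).
    rewrite !subr_eq0 !eqr_nat -negb_and; apply/negP => /andP[/eqP eX /eqP eY].
    by move: hji; rewrite (XYinj _ _ eX eY) ltnn.
  move=> /(_ isT) pos.
  have : 0 < (den k)%:R * ((1 - y) * ((X i)%:R - (X j)%:R) + y * ((Y i)%:R - (Y j)%:R)).
    exact: mulr_gt0.
  have -> : (den k)%:R * ((1 - y) * ((X i)%:R - (X j)%:R) + y * ((Y i)%:R - (Y j)%:R)) =
      (v k i)%:R - (v k j)%:R :> R.
    rewrite /v !natrD !natrM natrB // /y; field; exact: lt0r_neq0.
  by rewrite subr_gt0 ltr_nat.
have lN (r : nat) : (r <= c i)%N -> ((l + r).+1%:R < N%:R * x2).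
  move=> rc; have : r%:R <= (c i)%:R :> R by rewrite ler_nat.
  rewrite -natr1 natrD /l -!natr1; lra.
have lN' (r : nat) : (r <= c i)%N -> (l + r < N)%N.
  move=> /lN h1; have : ((l + r).+1%:R < N%:R :> R).
    by apply: (lt_le_trans h1); rewrite ler_piMr // ler0n.
  by rewrite ltr_nat; apply: ltn_trans.
pose g (r : 'I_(c i).+1) : 'I_N := Ordinal (lN' r (ltn_ord r)).
have ginj : injective g by move=> r r' /(congr1 val) /= /addnI /val_inj.
have : (#|codom g| <= c i)%N.
  apply: subset_leq_card; apply/fintype.subsetP => _ /codomP[r ->]; apply: good => /=.
    exact: leq_addr.
  exact: lN (ltn_ord r).
by rewrite card_codom // card_ord ltnn.
Qed.

Local Open Scope classical_set_scope.

(** * Visible angles and their limits *)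

Lemma cos_sin_sum_bounds (R : realType) (t : R) : 0 <= t <= pi / 2 ->
  [/\ 0 <= cos t, 0 <= sin t, 0 < cos t + sin t & (cos t + sin t) ^+ 2 <= 2].
Proof.
move=> /andP[t0 t1].
have p0 := pi_gt0 R.
have c0 : 0 <= cos t by apply: cos_ge0_pihalf; lra.
have s0 : 0 <= sin t by apply: sin_ge0_pi; lra.
have e := cos2Dsin2 t.
split => //; last by have := sqr_ge0 (cos t - sin t); nra.
rewrite lt_neqAle addr_ge0 // andbT eq_sym paddr_eq0 //.
apply/negP => /andP[/eqP cz /eqP sz]; move: e; rewrite cz sz; lra.
Qed.

(* (cos t, sin t) is a positive multiple of (1 - slope t, slope t); unlike the tangent,
   this coordinate is bounded on the whole closed quadrant. *)
Definition slope (R : realType) (t : R) : R := sin t / (cos t + sin t).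

Lemma slope_itv (R : realType) (t : R) : 0 <= t <= pi / 2 -> 0 <= slope t <= 1.
Proof.
move=> /cos_sin_sum_bounds[c0 s0 cs _]; rewrite /slope divr_ge0 ?(ltW cs) //=.
by rewrite ler_pdivrMr // mul1r lerDr.
Qed.

(** Mean value theorem: the derivative of [slope] is [(cos t + sin t)^-2], which is at least [1 / 2]
    on the quadrant. *)
Lemma slope_expanding (R : realType) (t1 t2 : R) : 0 <= t1 -> t1 <= t2 -> t2 <= pi / 2 ->
  t2 - t1 <= 2 * (slope t2 - slope t1).
Proof.
move=> h0 h12 h2.
have der (t : R) : 0 <= t <= pi / 2 -> is_derive t 1 (@slope R) ((cos t + sin t) ^- 2).
  move=> /cos_sin_sum_bounds[_ _ cs _].
  have cs0 : cos t + sin t != 0 by exact: lt0r_neq0.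
  have d1 : is_derive t 1 (cos + sin) (- sin t + cos t) by exact: is_deriveD.
  have d2 := @is_deriveV R (cos + sin) t _ 1 cs0 d1.
  have d3 := is_deriveM (is_derive_sin t) d2.
  have -> : @slope R = sin * (fun y => ((cos + sin : R -> R) y)^-1) by exact/funext.
  apply: (is_derive_eq d3).
  rewrite /= /GRing.scale /= !fctE.
  have e := cos2Dsin2 t.
  rewrite -[RHS]div1r -e.
  by field.
have [||c cin ->] := @MVT_segment R (@slope R) (fun t => (cos t + sin t) ^- 2) t1 t2 h12.
- move=> t; rewrite in_itv /= => /andP[a b]; apply: der; lra.
- apply: derivable_within_continuous => t; rewrite in_itv /= => /andP[a b].
  have [|? _] := der t; first lra.
  by [].
move: cin; rewrite in_itv /= => /andP[a b].
have [|_ _ cs le2] := @cos_sin_sum_bounds R c; first lra.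
rewrite mulrA ler_peMl ?subr_ge0 // ler_pdivlMr ?mul1r // exprn_gt0 //.
Qed.

Lemma slope_ge0 (R : realType) (t p q : R) : 0 <= t <= pi / 2 ->
  0 <= cos t * p + sin t * q -> 0 <= (1 - slope t) * p + slope t * q.
Proof.
move=> /cos_sin_sum_bounds[_ _ cs _] h.
have -> : (1 - slope t) * p + slope t * q = (cos t * p + sin t * q) / (cos t + sin t).
  by rewrite /slope; field; exact: lt0r_neq0.
by rewrite divr_ge0 // ltW.
Qed.

(** The interval of radius [D] about any point of [A] serves as [J]; the resulting factor 2 only
    affects the final constant. *)
Lemma diameter_cover (R : realType) (A : set R) (D : R) : 0 <= D ->
  (forall t1 t2, A t1 -> A t2 -> t1 <= t2 -> t2 - t1 <= D) ->
  exists J : set R, [/\ measurable J, A `<=` J & (lebesgue_measure J <= (2 * D)%:E)%E].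
Proof.
move=> D0 diam; have [->|/set0P[c Ac]] := eqVneq A set0.
  by exists set0; split => //; rewrite measure0 lee_fin mulr_ge0.
exists `[c - D, c + D]%classic; split; first exact: measurable_itv.
  move=> t At /=; rewrite in_itv /=; case: (leP t c) => h.
    by have := diam _ _ At Ac h; lra.
  by have := diam _ _ Ac At (ltW h); lra.
rewrite lebesgue_measure_itv /=; case: ifP => _; rewrite -?EFinD lee_fin; lra.
Qed.

(** By monotonicity the measure has a right limit at 0, namely its infimum; along [1 / (n + 1)]
    continuity from above identifies that limit with the measure of the intersection. *)
Lemma cvg_lebesgue_shrinking (R : realType) (A : R -> set R) (a b : R) :
  (forall e, 0 < e -> measurable (A e)) ->
  (forall e, 0 < e -> A e `<=` `[a, b]%classic) ->
  (forall e e', 0 < e -> e <= e' -> A e `<=` A e') ->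
  fine (lebesgue_measure (A e)) @[e --> 0^'+] -->
    fine (lebesgue_measure (\bigcap_n A n.+1%:R^-1)).
Proof.
move=> mA Aab Amono.
have finI : (lebesgue_measure (`[a, b]%classic : set R) < +oo)%E.
  by rewrite lebesgue_measure_itv /=; case: ifP => _; rewrite -?EFinD ltry.
have Afin e : 0 < e -> (lebesgue_measure (A e) < +oo)%E.
  move=> e0; apply: le_lt_trans finI; apply: le_measure; rewrite ?inE //.
  - exact: mA.
  - exact: Aab.
have Anum e : 0 < e -> lebesgue_measure (A e) \is a fin_num.
  by move=> e0; rewrite ge0_fin_numE //; exact: Afin.
set g := fun e => fine (lebesgue_measure (A e)).
have gcv := @nondecreasing_at_right_cvgr R g 0 +oo%O.
have {}gcv : g x @[x --> 0^'+] --> inf [set g x | x in [set` Interval (BRight (0:R)) +oo%O]].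
  apply: gcv => //.
  - move=> x y; rewrite !in_itv /= !andbT => x0 y0 xy; apply: fine_le; try exact: Anum.
    by apply: le_measure; rewrite ?inE; [exact: mA|exact: mA|exact: Amono].
  - by exists 0 => _ [x _ <-]; exact: fine_ge0.
pose u n : R := n.+1%:R^-1.
have u0 n : 0 < u n by rewrite invr_gt0 ltr0n.
have gu := (cvg_at_rightP _ _ _).1 gcv u (conj u0 (@cvg_harmonic R)).
have mcap : measurable (\bigcap_n A (u n)) by apply: bigcapT_measurable => n; exact: mA.
have capnum : lebesgue_measure (\bigcap_n A (u n)) \is a fin_num.
  rewrite ge0_fin_numE //; apply: le_lt_trans (Afin _ (u0 0%N)).
  by apply: le_measure; rewrite ?inE //; [exact: mA|exact: bigcap_inf].
have mcv := @nonincreasing_cvg_mu _ _ _ (@lebesgue_measure R) (A \o u) (Afin _ (u0 0%N))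
   (fun n => mA _ (u0 n)) mcap.
have {}mcv : fine (lebesgue_measure (A (u n))) @[n --> \oo] -->
    fine (lebesgue_measure (\bigcap_n A (u n))).
  apply: fine_cvg; rewrite fineK //; apply: mcv => n k nk.
  apply/subsetPset; apply: Amono => //.
  by rewrite /u lef_pV2 ?posrE ?ltr0n // ler_nat ltnS.
have -> : fine (lebesgue_measure (\bigcap_n A n.+1%:R^-1)) =
    inf [set g x | x in [set` Interval (BRight (0:R)) +oo%O]].
  exact: (cvg_unique _ mcv gu).
exact: gcv.
Qed.

(** The inequality is weak because, where the scalar product vanishes, the term of order [eps] in
    [visible_anglesE] keeps the boundary point visible for every [eps > 0]. *)
Definition limit_angles (R : realType) (m : nat) (f : grid_idx m -> 'I_(m * m))
  (i : grid_idx m) : set R :=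
  [set t | 0 <= t < 2 * pi /\ forall j : grid_idx m, (f j < f i)%N ->
     0 <= cos t * (gx i R - gx j R) + sin t * (gy i R - gy j R)].

(** The squared distance from the boundary point to the centre [eps * p_j] expands to 1 plus [eps]
    times the displayed expression. In this form the conditions are visibly monotone in [eps] and
    measurable in [t]. *)
Lemma visible_anglesE (R : realType) (m : nat) (f : grid_idx m -> 'I_(m * m))
  (eps : R) (i : grid_idx m) : 0 < eps ->
  visible_angles f eps i =
  `[0, 2 * pi[%classic `&` \bigcap_(j in [set j | (f j < f i)%N])
    [set t | 0 < eps * ((gx i R - gx j R) ^+ 2 + (gy i R - gy j R) ^+ 2) +
       2 * (cos t * (gx i R - gx j R) + sin t * (gy i R - gy j R))].
Proof.
move=> e0.
have key j t : (~ in_disk eps j (eps * gx i R + cos t) (eps * gy i R + sin t)) <->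
  0 < eps * ((gx i R - gx j R) ^+ 2 + (gy i R - gy j R) ^+ 2) +
       2 * (cos t * (gx i R - gx j R) + sin t * (gy i R - gy j R)).
  rewrite /in_disk.
  set lhs := (X in X <= 1); set rhs := (X in 0 < X).
  have -> : lhs = 1 + eps * rhs.
    by rewrite -[1](cos2Dsin2 t) /lhs /rhs; ring.
  rewrite -[X in _ <= X]addr0 lerD2l; split.
    by move/negP; rewrite -ltNge pmulr_rgt0.
  by move=> r0; apply/negP; rewrite -ltNge pmulr_rgt0.
apply/seteqP; split => t /=.
  by move=> [t0 h]; split; [rewrite in_itv|move=> j /= /h /key].
by move=> [t0 h]; split; [rewrite in_itv in t0|move=> j /h /key].
Qed.

Lemma measurable_visible_angles (R : realType) (m : nat) (f : grid_idx m -> 'I_(m * m))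
  (eps : R) (i : grid_idx m) : 0 < eps -> measurable (visible_angles f eps i).
Proof.
move=> e0; rewrite visible_anglesE //; apply: measurableI; first exact: measurable_itv.
apply: fin_bigcap_measurable; first exact: finite_finset.
move=> j _.
pose F (t : R) := eps * ((gx i R - gx j R) ^+ 2 + (gy i R - gy j R) ^+ 2) +
  2 * (cos t * (gx i R - gx j R) + sin t * (gy i R - gy j R)).
have mF : measurable_fun setT F.
  apply: measurable_funD => //; apply: measurable_funM => //.
  apply: measurable_funD; apply: measurable_funM => //; apply: continuous_measurable_fun.
    exact: continuous_cos.
  exact: continuous_sin.
have := mF measurableT `]0, +oo[%classic (measurable_itv _).
rewrite setTI; congr (measurable _).
by apply/seteqP; split => t /=; rewrite in_itv /= andbT.
Qed.

Lemma bigcap_visible_angles (R : realType) (m : nat) (f : grid_idx m -> 'I_(m * m))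
  (i : grid_idx m) :
  \bigcap_n visible_angles f (n.+1%:R^-1 : R) i = @limit_angles R m f i.
Proof.
have u0 n : 0 < (n.+1%:R^-1 : R) by rewrite invr_gt0 ltr0n.
apply/seteqP; split => t.
  move=> h; have := h 0%N I; rewrite /= => -[t0 _]; split => // j ji.
  set q := (X in 0 <= X); rewrite leNgt; apply/negP => q0.
  set D := (gx i R - gx j R) ^+ 2 + (gy i R - gy j R) ^+ 2.
  have D0 : 0 <= D by rewrite addr_ge0 // sqr_ge0.
  (* For such [n], [D / (n + 1) + 2 * q] is negative, so the angle is hidden at
     [eps = 1 / (n + 1)]. *)
  have [n] : exists n, D / (- 2 * q) < n%:R.
    by exists (Num.truncn (D / (- 2 * q))).+1; exact: truncnS_gt.
  rewrite ltr_pdivrMr; last by nra.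
  move=> Dn.
  have := h n I; rewrite visible_anglesE // => -[_] /(_ j ji) /=.
  rewrite -/q -/D => hn.
  have : 0 < n.+1%:R * (n.+1%:R^-1 * D + 2 * q) by rewrite mulr_gt0 // ltr0n.
  rewrite mulrDr mulVKf ?pnatr_eq0 // -natr1.
  have n0 : 0 <= n%:R :> R by rewrite ler0n.
  nra.
move=> [t0 h] n _; rewrite visible_anglesE //; split; first by rewrite /= in_itv.
move=> j /= ji; apply: ltr_pwDl; last by rewrite mulr_ge0 // h.
apply: mulr_gt0 => //; rewrite lt_neqAle addr_ge0 ?sqr_ge0 // andbT eq_sym.
rewrite paddr_eq0 ?sqr_ge0 // !sqrf_eq0 !subr_eq0 /gx /gy !eqr_nat !eqSS.
apply/negP => /andP[/eqP e1 /eqP e2]; suff e : i = j by move: ji; rewrite e ltnn.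
by case: i j e1 e2 {h ji} => [i1 i2] [j1 j2] /= /val_inj -> /val_inj ->.
Qed.

Lemma cvg_vis (R : realType) (m : nat) (f : grid_idx m -> 'I_(m * m)) :
  vis f eps @[eps --> (0 : R)^'+] -->
    \sum_(i : grid_idx m) fine (lebesgue_measure (@limit_angles R m f i)).
Proof.
rewrite /vis; apply: cvg_big => [|i _]; first exact: add_continuous.
rewrite -bigcap_visible_angles.
apply: (@cvg_lebesgue_shrinking R (fun e => visible_angles f e i) 0 (2 * pi)).
- by move=> e e0; exact: measurable_visible_angles.
- move=> e e0 t [/andP[t0 t1] _]; rewrite /= in_itv /= t0 ltW //.
- move=> e e' e0 ee'; have e'0 := lt_le_trans e0 ee'.
  rewrite !visible_anglesE // => t [t0 h]; split => // j /h /=.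
  move=> hj; apply: (lt_le_trans hj); rewrite lerD2r ler_wpM2r //.
  by rewrite addr_ge0 // sqr_ge0.
Qed.

(** * The four quadrants of directions and the final bound *)

(** Turning by [w] reduces any quadrant to the first one, with [X] and [Y] as the turned grid
    coordinates. The factor 4 is 2 from [slope_expanding] times 2 from [diameter_cover]. *)
Lemma limit_angles_quadrant (R : realType) (m s : nat) (f : grid_idx m -> 'I_(m * m))
  (X Y : grid_idx m -> nat) (w : R) :
  injective f -> (0 < s)%N ->
  (forall i j, X i = X j -> Y i = Y j -> i = j) ->
  (forall i, (X i < m)%N) -> (forall i, (Y i < m)%N) ->
  (forall t i j, cos (t + w) * (gx i R - gx j R) + sin (t + w) * (gy i R - gy j R) =
     cos t * ((X i)%:R - (X j)%:R) + sin t * ((Y i)%:R - (Y j)%:R)) ->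
  exists c : grid_idx m -> nat,
    \sum_i ((c i)%:R : R) <= 17 * s%:R ^+ 3 * m%:R /\
    forall i, exists J : set R, [/\ measurable J,
      @limit_angles R m f i `&` `[w, w + pi / 2]%classic `<=` J &
      (lebesgue_measure J <= (4 * (((c i)%:R + 3) / s%:R ^+ 2))%:E)%E].
Proof.
move=> finj s0 XYinj Xm Ym rot.
have hinj : injective (fun i => f i : nat) by move=> i j /val_inj /finj.
have [c [csum cP]] := @record_intervals R _ m s _ X Y hinj XYinj Xm Ym s0.
exists c; split => // i.
set D := ((c i)%:R + 3) / s%:R ^+ 2.
have D0 : 0 <= D by rewrite divr_ge0 ?exprn_ge0 ?addr_ge0 ?ler0n.
have -> : 4 * D = 2 * (2 * D) by ring.
apply: diameter_cover; first by rewrite mulr_ge0.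
have norm t : (@limit_angles R m f i `&` `[w, w + pi / 2]%classic) t ->
  0 <= t - w <= pi / 2 /\ forall j, (f j < f i)%N ->
    0 <= (1 - slope (t - w)) * ((X i)%:R - (X j)%:R) + slope (t - w) * ((Y i)%:R - (Y j)%:R).
  move=> [[_ h]]; rewrite /= in_itv /= => /andP[a b].
  have ab : 0 <= t - w <= pi / 2 by lra.
  split=> // j /h; rewrite -[in cos t](subrK w t) -[in sin t](subrK w t) rot => hj.
  exact: slope_ge0.
move=> t1 t2 /norm[/andP[a1 b1] h1] /norm[/andP[a2 b2] h2] t12.
have := @slope_expanding R (t1 - w) (t2 - w) a1 _ b2; rewrite lerD2r => /(_ t12).
have /andP[x10 _] : 0 <= slope (t1 - w) <= 1 by apply: slope_itv; rewrite a1.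
have /andP[_ x21] : 0 <= slope (t2 - w) <= 1 by apply: slope_itv; rewrite a2.
have := cP i _ _ x10 x21 h1 h2; rewrite -/D; lra.
Qed.

Lemma measurable_limit_angles (R : realType) (m : nat) (f : grid_idx m -> 'I_(m * m))
  (i : grid_idx m) : measurable (@limit_angles R m f i).
Proof.
rewrite -bigcap_visible_angles; apply: bigcapT_measurable => n.
by apply: measurable_visible_angles; rewrite invr_gt0 ltr0n.
Qed.

Lemma sum_limit_angles_le (R : realType) (m s : nat) (f : grid_idx m -> 'I_(m * m)) :
  injective f -> (0 < s)%N ->
  \sum_(i : grid_idx m) fine (lebesgue_measure (@limit_angles R m f i)) <=
    272 * s%:R * m%:R + 48 * m%:R ^+ 2 / s%:R ^+ 2.
Proof.
move=> finj s0.
pose x (i : grid_idx m) : nat := i.1.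
pose y (i : grid_idx m) : nat := i.2.
(* Reversing a coordinate negates its differences while keeping its values natural numbers below
   [m]; this realises the quarter turns. *)
pose x' (i : grid_idx m) : nat := rev_ord i.1.
pose y' (i : grid_idx m) : nat := rev_ord i.2.
have gxE i j : gx i R - gx j R = (x i)%:R - (x j)%:R by rewrite /gx /x -!natr1; ring.
have gyE i j : gy i R - gy j R = (y i)%:R - (y j)%:R by rewrite /gy /y -!natr1; ring.
have x'E i : (x' i)%:R = m%:R - (x i)%:R - 1 :> R.
  by rewrite /x' /x /= natrB ?ltn_ord // -natr1; ring.
have y'E i : (y' i)%:R = m%:R - (y i)%:R - 1 :> R.
  by rewrite /y' /y /= natrB ?ltn_ord // -natr1; ring.
have inj (i j : grid_idx m) : i.1 = j.1 -> i.2 = j.2 -> i = j.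
  by case: i j => [i1 i2] [j1 j2] /= -> ->.
have vi (a b : 'I_m) : a = b :> nat -> a = b by exact: val_inj.
have ri (a b : 'I_m) : rev_ord a = rev_ord b :> nat -> a = b.
  by move=> /val_inj /rev_ord_inj.
have lx i : (x i < m)%N := ltn_ord _. have ly i : (y i < m)%N := ltn_ord _.
have lx' i : (x' i < m)%N := ltn_ord _. have ly' i : (y' i < m)%N := ltn_ord _.
have [|t i j|c0 [S0 P0]] := @limit_angles_quadrant R m s f x y 0 finj s0 _ lx ly.
- by move=> i j /vi e1 /vi e2; exact: inj.
- by rewrite addr0 gxE gyE.
have [|t i j|c1 [S1 P1]] := @limit_angles_quadrant R m s f y x' (pi / 2) finj s0 _ ly lx'.
- by move=> i j /vi e1 /ri e2; exact: inj.
- by rewrite cosDpihalf sinDpihalf gxE gyE !x'E; ring.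
have [|t i j|c2 [S2 P2]] := @limit_angles_quadrant R m s f x' y' pi finj s0 _ lx' ly'.
- by move=> i j /ri e1 /ri e2; exact: inj.
- by rewrite cosDpi sinDpi gxE gyE !x'E !y'E; ring.
have [|t i j|c3 [S3 P3]] := @limit_angles_quadrant R m s f y' x (pi + pi / 2) finj s0 _ ly' lx.
- by move=> i j /ri e1 /vi e2; exact: inj.
- by rewrite addrA cosDpihalf sinDpihalf cosDpi sinDpi gxE gyE !y'E; ring.
have sR0 : 0 < s%:R :> R by rewrite ltr0n.
pose bnd (c : grid_idx m -> nat) i : R := 4 * (((c i)%:R + 3) / s%:R ^+ 2).
have each i : fine (lebesgue_measure (@limit_angles R m f i)) <=
    (bnd c0 i + bnd c1 i) + (bnd c2 i + bnd c3 i).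
  have [J0 [mJ0 sub0 le0]] := P0 i; have [J1 [mJ1 sub1 le1]] := P1 i.
  have [J2 [mJ2 sub2 le2]] := P2 i; have [J3 [mJ3 sub3 le3]] := P3 i.
  have sub : @limit_angles R m f i `<=` (J0 `|` J1) `|` (J2 `|` J3).
    move=> t Lt; have [/andP[t0 t1] _] := Lt.
    have p0 := pi_gt0 R.
    have inq w : w <= t -> t <= w + pi / 2 ->
        (@limit_angles R m f i `&` `[w, w + pi / 2]%classic) t.
      by move=> a b; split => //=; rewrite in_itv /= a b.
    case: (leP t (pi / 2)) => h1; first by left; left; apply: sub0; apply: inq; lra.
    case: (leP t pi) => h2; first by left; right; apply: sub1; apply: inq; lra.
    case: (leP t (pi + pi / 2)) => h3; first by right; left; apply: sub2; apply: inq; lra.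
    by right; right; apply: sub3; apply: inq; lra.
  have le : (lebesgue_measure (@limit_angles R m f i) <=
      ((bnd c0 i + bnd c1 i) + (bnd c2 i + bnd c3 i))%:E)%E.
    apply: (@le_trans _ _ (lebesgue_measure ((J0 `|` J1) `|` (J2 `|` J3)))).
      apply: le_measure; rewrite ?inE //; first exact: measurable_limit_angles.
      by do !apply: measurableU.
    apply: le_trans (measureU2 _ _ _) _; try exact: measurableU.
    rewrite EFinD; apply: leeD; apply: le_trans (measureU2 _ _ _) _ => //;
      by rewrite EFinD; apply: leeD.
  rewrite -lee_fin fineK // ge0_fin_numE //.
  by apply: le_lt_trans le _; rewrite ltry.
apply: (le_trans (ler_sum _ (fun i _ => each i))).
(* Per quadrant, [68 = 4 * 17] and [12 = 4 * 3], the 3 being summed over the [m^2] points; four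
   quadrants give 272 and 48. *)
have sumb c : \sum_i ((c i)%:R : R) <= 17 * s%:R ^+ 3 * m%:R ->
    \sum_i bnd c i <= 68 * s%:R * m%:R + 12 * m%:R ^+ 2 / s%:R ^+ 2.
  move=> cs; rewrite -mulr_sumr -mulr_suml big_split /= sumr_const card_prod !card_ord.
  have -> : 68 * s%:R * m%:R + 12 * m%:R ^+ 2 / s%:R ^+ 2 =
     4 * ((17 * s%:R ^+ 3 * m%:R + 3 *+ (m * m)) / s%:R ^+ 2) :> R.
    by rewrite -[3 *+ _]mulr_natr natrM; field; exact: lt0r_neq0.
  by rewrite ler_wpM2l // ler_wpM2r ?invr_ge0 ?exprn_ge0 ?ler0n // lerD2r.
rewrite !big_split /=.
have b0 := sumb _ S0; have b1 := sumb _ S1; have b2 := sumb _ S2; have b3 := sumb _ S3.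
lra.
Qed.

Theorem theorem5 (R : realType) :
  exists K : R, 0 < K /\
    forall (m : nat) (f : grid_idx m -> 'I_(m * m)), bijective f ->
      exists L : R,
        vis f eps @[eps --> 0^'+] --> L /\
        L <= K * ((m ^ 2)%:R `^ (2 / 3 : R)).
Proof.
(* [592 = 2 * 272 + 48], from [s <= 2 * y] in the first term and [y <= s] in the second, where [y]
   is the cube root of [m]. *)
exists 592; split; first by rewrite ltr0n.
move=> m f /bij_inj finj.
exists (\sum_(i : grid_idx m) fine (lebesgue_measure (@limit_angles R m f i))).
split; first exact: cvg_vis.
have [m0|m0] := posnP m.
  subst m; rewrite big1; last by case=> -[].
  by apply: mulr_ge0; [rewrite ler0n|exact: powR_ge0].
pose y : R := m%:R `^ (3^-1).
have mR : 0 <= m%:R :> R by rewrite ler0n.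
have y0 : 0 <= y by rewrite powR_ge0.
have y3 : y ^+ 3 = m%:R.
  by rewrite -powR_mulrn // -powRrM mulVf ?pnatr_eq0 // powRr1.
have y1 : 1 <= y.
  rewrite leNgt; apply/negP => ylt; have : y ^+ 3 < 1 by rewrite exprn_ilt1.
  by rewrite y3 ltNge ler1n m0.
have -> : (m ^ 2)%:R `^ (2 / 3) = y ^+ 4.
  rewrite natrX -y3 -exprM -[y ^+ (3 * 2)]powR_mulrn // -powRrM -[RHS]powR_mulrn //.
  by congr (_ `^ _); lra.
(* This [s] balances [m * s] against [m^2 / s^2], both then being of order [y^4]; [s <= 2 * y]
   relies on [y >= 1], which is why [m = 0] was treated apart. *)
pose s := (Num.truncn y).+1.
have /andP[s1 s2] := truncn_itv y0.
have ys : y <= s%:R by rewrite ltW.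
have sy : s%:R <= 2 * y by rewrite /s -natr1; lra.
apply: le_trans (@sum_limit_angles_le R m s f finj _) _ => //.
have s0 : 0 < s%:R :> R by rewrite ltr0n.
have A1 : 272 * s%:R * m%:R <= 544 * y ^+ 4.
  have -> : 544 * y ^+ 4 = 272 * (2 * y) * m%:R by rewrite -y3; ring.
  by rewrite ler_wpM2r // ler_wpM2l.
have A2 : 48 * m%:R ^+ 2 / s%:R ^+ 2 <= 48 * y ^+ 4.
  rewrite ler_pdivrMr ?exprn_gt0 // -y3.
  have -> : 48 * (y ^+ 3) ^+ 2 = 48 * y ^+ 4 * y ^+ 2 by ring.
  rewrite ler_wpM2l ?mulr_ge0 ?exprn_ge0 // lerXn2r ?nnegrE // ltW //.
lra.
Qed.
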